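(* Let $d_x,d_y\ge 1$ and let $\mathbf{B}\in\mathbb{R}^{d_x\times d_y}$ with $\mathbf{B}\ne 0$. Consider the min-max problem $\min_{x\in\mathbb{R}^{d_x}}\max_{y\in\mathbb{R}^{d_y}} x^\top \mathbf{B}y$. Let $(\alpha_t)_{t\ge 0}$, $(\beta_t)_{t\ge 0}$ be real stepsize sequences falling under at least one of the following categories: (i) (constant stepsizes) there are $\alpha,\beta\in\mathbb{R}$ with $\alpha_t=\alpha$ and $\beta_t=\beta$ for all $t$; (ii) (non-negative stepsizes) $\alpha_t\ge 0$ and $\beta_t\ge 0$ for all $t$; (iii) (symmetric stepsizes) $\alpha_t=\beta_t$ for all $t$. Then gradient-descent-ascent (GDA) with these stepsizes does not converge on this problem: it is not the case that, for every initialization $(x_0,y_0)\in\mathbb{R}^{d_x}\times\mathbb{R}^{d_y}$, the iterates $(x_t,y_t)$ converge to a saddle point of the problem.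
   Context: For a differentiable function $f(x,y)$, GDA with stepsizes $\alpha_t,\beta_t\in\mathbb{R}$ is the iteration $x_{t+1}=x_t-\alpha_t\nabla_x f(x_t,y_t)$, $y_{t+1}=y_t+\beta_t\nabla_y f(x_t,y_t)$ (both gradients evaluated at $(x_t,y_t)$). Here $f(x,y)=x^\top\mathbf{B}y$. A saddle point of $f$ is a point $(x^*,y^* )$ with $f(x^*,y)\le f(x^*,y^* )\le f(x,y^* )$ for all $x,y$; for this problem the saddle points are exactly the points with $x^*\in\ker(\mathbf{B}^\top)$ and $y^*\in\ker(\mathbf{B})$. *)

(* Defs.v *)
From mathcomp Require Import all_boot all_order all_algebra.
From mathcomp Require Import all_classical all_reals all_analysis.
Import Order.TTheory GRing.Theory Num.Theory numFieldNormedType.Exports.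

Set Implicit Arguments.
Unset Strict Implicit.
Unset Printing Implicit Defensive.

Local Open Scope classical_set_scope.
Local Open Scope ring_scope.

Definition gradient (R : realType) (n : nat) (g : 'cV[R]_n -> R)
    (p : 'cV[R]_n) : 'cV[R]_n :=
  \col_i 'D_(delta_mx i 0) g p.

Definition grad_x (R : realType) (dx dy : nat)
    (f : 'cV[R]_dx -> 'cV[R]_dy -> R) (x : 'cV[R]_dx) (y : 'cV[R]_dy) :
    'cV[R]_dx :=
  gradient (fun x' => f x' y) x.

Definition grad_y (R : realType) (dx dy : nat)
    (f : 'cV[R]_dx -> 'cV[R]_dy -> R) (x : 'cV[R]_dx) (y : 'cV[R]_dy) :
    'cV[R]_dy :=
  gradient (fun y' => f x y') y.

(* Simultaneous updates: both gradients are evaluated at the old iterate. *)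
Definition gda_step (R : realType) (dx dy : nat)
    (f : 'cV[R]_dx -> 'cV[R]_dy -> R) (a b : R)
    (z : 'cV[R]_dx * 'cV[R]_dy) : 'cV[R]_dx * 'cV[R]_dy :=
  (z.1 - a *: grad_x f z.1 z.2, z.2 + b *: grad_y f z.1 z.2).

Fixpoint gda (R : realType) (dx dy : nat)
    (f : 'cV[R]_dx -> 'cV[R]_dy -> R) (alpha beta : nat -> R)
    (z0 : 'cV[R]_dx * 'cV[R]_dy) (t : nat) : 'cV[R]_dx * 'cV[R]_dy :=
  if t is s.+1
  then gda_step f (alpha s) (beta s) (gda f alpha beta z0 s)
  else z0.

Definition saddle_point (R : realType) (dx dy : nat)
    (f : 'cV[R]_dx -> 'cV[R]_dy -> R) (z : 'cV[R]_dx * 'cV[R]_dy) : Prop :=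
  forall (x : 'cV[R]_dx) (y : 'cV[R]_dy),
    f z.1 y <= f z.1 z.2 /\ f z.1 z.2 <= f x z.2.

Definition gda_converges (R : realType) (dx dy : nat)
    (f : 'cV[R]_dx -> 'cV[R]_dy -> R) (alpha beta : nat -> R) : Prop :=
  forall z0 : 'cV[R]_dx * 'cV[R]_dy,
    exists2 z : 'cV[R]_dx * 'cV[R]_dy,
      saddle_point f z & gda f alpha beta z0 t @[t --> \oo] --> z.

(* The product is a 1 x 1 matrix; (0, 0) selects its only entry. *)
Definition bilinear_payoff (R : realType) (dx dy : nat) (B : 'M[R]_(dx, dy))
    (x : 'cV[R]_dx) (y : 'cV[R]_dy) : R :=
  (x^T *m B *m y) 0 0.

Definition constant_steps (R : realType) (alpha beta : nat -> R) : Prop :=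
  exists a b : R, forall t : nat, alpha t = a /\ beta t = b.

Definition nonneg_steps (R : realType) (alpha beta : nat -> R) : Prop :=
  forall t : nat, 0 <= alpha t /\ 0 <= beta t.

Definition symmetric_steps (R : realType) (alpha beta : nat -> R) : Prop :=
  forall t : nat, alpha t = beta t.

(* Main.v *)
Require Import Defs.
From mathcomp Require Import all_boot all_order all_algebra.
From mathcomp Require Import all_classical all_reals all_analysis.
From mathcomp Require Import ring lra.
Import Order.TTheory GRing.Theory Num.Theory numFieldNormedType.Exports.

(** For f (x, y) = x^T B y the iteration is x' = x - a B y, y' = y + b B^T x.
    With G = B^T B and xi = B^T x it becomes xi' = xi - a G y, y' = y + b xi,
    so it can be followed through the moments q_k (u, v) = u^T G^k v.  These
    are symmetric bilinear forms, nonnegative on the diagonal, and G only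
    raises the index k.  For two trajectories (xi, y) and (eta, z), one step
    expands as (moment_gdaS)

      q_k (xi', z') = q_k (xi, z) - a q_{k+1} (y, z) + b q_k (xi, eta)
                      - a b q_{k+1} (eta, y).

    In both sign regimes some quantity built from the q_k then satisfies
    Q_k' >= Q_k + c Q_{k+1} with c >= 0 and Q_k >= 0 initially; hence Q_0 never
    drops below its initial value, which is made positive.

    - If a_t b_t >= 0 for all t, take two trajectories and antisymmetrize.  The
      first-order terms cancel because the moments are symmetric, and
      c = a_t b_t.  In the plane of one pair of singular vectors Q_0 is a
      signed area, and the step has determinant 1 + a b sigma^2 >= 1: areas do
      not shrink.
    - If a_t and b_t have constant opposite signs, take one trajectory and
      Q_k = s q_k (xi, y) with s = 1 or -1 chosen so that the first-order terms
      are nonnegative; then c = - a_t b_t.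

    On the other hand Q_0 is a combination of values of the payoff, and payoffs
    tend to 0 along trajectories that converge to saddle points, since
    f (x*, y) = 0 for every y when x* belongs to a saddle point.  This
    contradicts the lower bound on Q_0.  Non-negative and symmetric stepsizes
    fall in the first regime, constant ones in one of the two.

    Carrying all the powers of G at once plays the part that restricting to the
    plane of one pair of singular vectors would play. *)

Set Implicit Arguments.
Unset Strict Implicit.
Unset Printing Implicit Defensive.

Local Open Scope classical_set_scope.
Local Open Scope ring_scope.

(** * Moments of the Gram matrix *)

(** The iteration is linear in (B^T x, y), with B^T B as only matrix, so these
    forms on the space of y are enough to follow it. *)
Definition moment (R : realType) (m n : nat) (B : 'M[R]_(m, n)) (k : nat)
    (u v : 'cV[R]_n) : R :=
  (u^T *m (B^T *m B) ^+ k *m v) 0 0.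

Lemma momentDl (R : realType) (m n : nat) (B : 'M[R]_(m, n)) (k : nat)
    (a : R) (u u' v : 'cV[R]_n) :
  moment B k (u + a *: u') v = moment B k u v + a * moment B k u' v.
Proof. by rewrite /moment linearD linearZ /= !mulmxDl -!scalemxAl !mxE. Qed.

Lemma momentDr (R : realType) (m n : nat) (B : 'M[R]_(m, n)) (k : nat)
    (a : R) (u v v' : 'cV[R]_n) :
  moment B k u (v + a *: v') = moment B k u v + a * moment B k u v'.
Proof. by rewrite /moment mulmxDr -scalemxAr !mxE. Qed.

Lemma moment0l (R : realType) (m n : nat) (B : 'M[R]_(m, n)) (k : nat)
    (v : 'cV[R]_n) :
  moment B k 0 v = 0.
Proof. by rewrite /moment trmx0 !mul0mx mxE. Qed.

Lemma trmx_gramX (R : realType) (m n : nat) (B : 'M[R]_(m, n)) (k : nat) :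
  ((B^T *m B) ^+ k)^T = (B^T *m B) ^+ k.
Proof.
elim: k => [|k IHk]; first by rewrite !expr0 trmx1.
by rewrite exprS trmx_mul IHk trmx_mul trmxK -[RHS]exprS exprSr.
Qed.

Lemma momentC (R : realType) (m n : nat) (B : 'M[R]_(m, n)) (k : nat)
    (u v : 'cV[R]_n) :
  moment B k u v = moment B k v u.
Proof.
rewrite /moment (_ : u^T *m _ *m v = (v^T *m (B^T *m B) ^+ k *m u)^T) ?mxE //.
by rewrite !trmx_mul trmxK trmx_gramX mulmxA.
Qed.

Lemma moment_gramr (R : realType) (m n : nat) (B : 'M[R]_(m, n)) (k : nat)
    (u v : 'cV[R]_n) :
  moment B k u (B^T *m (B *m v)) = moment B k.+1 u v.
Proof. by rewrite /moment exprSr !mulmxA. Qed.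

Lemma moment_graml (R : realType) (m n : nat) (B : 'M[R]_(m, n)) (k : nat)
    (u v : 'cV[R]_n) :
  moment B k (B^T *m (B *m u)) v = moment B k.+1 u v.
Proof. by rewrite momentC moment_gramr momentC. Qed.

Lemma sqnorm_ge0 (R : realType) (n : nat) (u : 'cV[R]_n) :
  0 <= (u^T *m u) 0 0.
Proof. by rewrite mxE sumr_ge0 // => i _; rewrite mxE -expr2 sqr_ge0. Qed.

Lemma sqnorm_gt0 (R : realType) (n : nat) (u : 'cV[R]_n) :
  u != 0 -> 0 < (u^T *m u) 0 0.
Proof.
apply: contra_neqT; rewrite lt_neqAle sqnorm_ge0 andbT negbK eq_sym mxE.
rewrite psumr_eq0 => [/allP u0|i _]; last by rewrite mxE -expr2 sqr_ge0.
apply/colP => i; have := u0 i (mem_index_enum i).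
by rewrite !mxE -expr2 sqrf_eq0 => /eqP.
Qed.

Lemma moment1E (R : realType) (m n : nat) (B : 'M[R]_(m, n))
    (v : 'cV[R]_n) :
  moment B 1 v v = ((B *m v)^T *m (B *m v)) 0 0.
Proof. by rewrite /moment expr1 trmx_mul !mulmxA. Qed.

(** Splitting off one Gram matrix on each side lowers k by two, which leaves the
    squared norms of v (k = 0) and of B v (k = 1). *)
Lemma moment_ge0 (R : realType) (m n : nat) (B : 'M[R]_(m, n)) (k : nat)
    (v : 'cV[R]_n) :
  0 <= moment B k v v.
Proof.
elim/ltn_ind: k v => -[|[|k]] IHk v.
- by rewrite /moment expr0 mulmx1 sqnorm_ge0.
- by rewrite moment1E sqnorm_ge0.
- by rewrite -moment_gramr -moment_graml IHk.
Qed.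

Lemma payoff_moment (R : realType) (m n : nat) (B : 'M[R]_(m, n))
    (x : 'cV[R]_m) (y : 'cV[R]_n) :
  bilinear_payoff B x y = moment B 0 (B^T *m x) y.
Proof. by rewrite /moment expr0 mulmx1 trmx_mul trmxK. Qed.

(** * The iteration on a bilinear payoff *)

(** Along the line the difference quotient equals c at every h <> 0, so its limit
    is that of a function constant near 0. *)
Lemma derive_affine (R : realType) (n : nat) (g : 'cV[R]_n -> R)
    (p v : 'cV[R]_n) (c : R) :
  (forall h : R, g (h *: v + p) = h * c + g p) -> 'D_v g p = c.
Proof.
move=> gE; apply: (lim_near_cst (@norm_hausdorff _ _)).
near=> h.
rewrite /= gE addrK -[_ *: _]/(_ * _) mulrA mulVf ?mul1r //.
by near: h; exact: nbhs_dnbhs_neq.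
Unshelve. all: by end_near.
Qed.

Lemma grad_x_bilinear (R : realType) (m n : nat) (B : 'M[R]_(m, n))
    (x : 'cV[R]_m) (y : 'cV[R]_n) :
  grad_x (bilinear_payoff B) x y = B *m y.
Proof.
apply/colP => i; rewrite mxE; apply: derive_affine => h.
rewrite /bilinear_payoff linearD linearZ /= !mulmxDl -!scalemxAl.
by rewrite trmx_delta -!rowE -row_mul !mxE.
Qed.

Lemma grad_y_bilinear (R : realType) (m n : nat) (B : 'M[R]_(m, n))
    (x : 'cV[R]_m) (y : 'cV[R]_n) :
  grad_y (bilinear_payoff B) x y = B^T *m x.
Proof.
apply/colP => i; rewrite mxE; apply: derive_affine => h.
rewrite /bilinear_payoff mulmxDr -scalemxAr -colE.
have -> : B^T *m x = (x^T *m B)^T by rewrite trmx_mul trmxK.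
by rewrite 2!mxE [col _ _ _ _]mxE [_^T _ _]mxE.
Qed.

Lemma gda_bilinearS (R : realType) (m n : nat) (B : 'M[R]_(m, n))
    (alpha beta : nat -> R) (z : 'cV[R]_m * 'cV[R]_n) (t : nat) :
  gda (bilinear_payoff B) alpha beta z t.+1
  = let w := gda (bilinear_payoff B) alpha beta z t in
    (w.1 - alpha t *: (B *m w.2), w.2 + beta t *: (B^T *m w.1)).
Proof. by rewrite /= /gda_step grad_x_bilinear grad_y_bilinear. Qed.

(** Two initial points are allowed because the case of stepsizes of equal signs
    compares two trajectories.  The second-order term has the roles of z and z'
    exchanged; this is what makes antisymmetrization reproduce the same
    quantity with k + 1 in place of k. *)
Lemma moment_gdaS (R : realType) (m n : nat) (B : 'M[R]_(m, n))
    (alpha beta : nat -> R) (z z' : 'cV[R]_m * 'cV[R]_n) (t k : nat) :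
  let w := gda (bilinear_payoff B) alpha beta z in
  let w' := gda (bilinear_payoff B) alpha beta z' in
  moment B k (B^T *m (w t.+1).1) (w' t.+1).2
  = moment B k (B^T *m (w t).1) (w' t).2
    - alpha t * moment B k.+1 (w t).2 (w' t).2
    + beta t * moment B k (B^T *m (w t).1) (B^T *m (w' t).1)
    - alpha t * beta t * moment B k.+1 (B^T *m (w' t).1) (w t).2.
Proof.
move=> w w'; rewrite /w /w' !gda_bilinearS /= -/w -/w'.
rewrite mulmxBr -scalemxAr -scaleNr momentDl !momentDr !moment_graml.
by rewrite [moment B k.+1 _.2 (B^T *m _)]momentC; ring.
Qed.

(** All the q _ k are carried together: each one is kept from decreasing by the
    nonnegativity of the next. *)
Lemma moment_sequence_no_decay (R : realType) (q : nat -> nat -> R)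
    (c : nat -> R) :
  (forall t, 0 <= c t) -> (forall k, 0 <= q 0%N k) -> 0 < q 0%N 0%N ->
  (forall t k, q t k + c t * q t k.+1 <= q t.+1 k) ->
  ~ (q t 0%N @[t --> \oo] --> (0 : R)).
Proof.
move=> c_ge0 q0_ge0 q00_gt0 qS q_cvg0.
have q_mono t : forall k, q 0%N k <= q t k.
  elim: t => [//|t IHt] k; apply: le_trans (IHt k) (le_trans _ (qS t k)).
  by rewrite lerDl mulr_ge0 // (le_trans (q0_ge0 k.+1)).
suff : q 0%N 0%N <= 0 by rewrite leNgt q00_gt0.
by apply: cvgr_to_ge q_cvg0 _; near=> t; exact: q_mono.
Unshelve. all: by end_near.
Qed.

(** * Payoffs along converging trajectories *)

(** The linear form y |-> x*^T B y is bounded above, being maximal at y*, hence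
    vanishes. *)
Lemma saddle_payoff0 (R : realType) (m n : nat) (B : 'M[R]_(m, n))
    (z : 'cV[R]_m * 'cV[R]_n) (y : 'cV[R]_n) :
  saddle_point (bilinear_payoff B) z -> bilinear_payoff B z.1 y = 0.
Proof.
move=> zP; have le_shift a : a * bilinear_payoff B z.1 y <= 0.
  have [+ _] := zP z.1 (z.2 + a *: y).
  by rewrite !payoff_moment momentDr gerDl.
by apply/eqP; have := le_shift 1; have := le_shift (-1); lra.
Qed.

Lemma cvg_bilinear_payoff (R : realType) (m n : nat) (B : 'M[R]_(m, n))
    (z z' : nat -> 'cV[R]_m * 'cV[R]_n) (l l' : 'cV[R]_m * 'cV[R]_n) :
  z t @[t --> \oo] --> l -> z' t @[t --> \oo] --> l' ->
  bilinear_payoff B (z t).1 (z' t).2 @[t --> \oo]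
    --> bilinear_payoff B l.1 l'.2.
Proof.
move=> zl z'l'.
have payoffE x y :
    bilinear_payoff B x y = \sum_j (\sum_i x i 0 * B i j) * y j 0.
  rewrite /bilinear_payoff mxE; apply: eq_bigr => j _; rewrite mxE.
  by congr (_ * _); apply: eq_bigr => i _; rewrite mxE.
rewrite payoffE (_ : (fun t => _) = fun t =>
  \sum_j (\sum_i (z t).1 i 0 * B i j) * (z' t).2 j 0); last first.
  by apply/funext => t; rewrite payoffE.
have z1 : (z t).1 @[t --> \oo] --> l.1.
  by apply: cvg_comp zl _; exact: cvg_fst.
have z2 : (z' t).2 @[t --> \oo] --> l'.2.
  by apply: cvg_comp z'l' _; exact: cvg_snd.
apply: cvg_big => [|j _]; first exact: add_continuous.
apply: cvgM; last first.
  exact: cvg_comp z2 (@coord_continuous _ _ _ j 0 _).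
apply: cvg_big => [|i _]; first exact: add_continuous.
apply: cvgM; last exact: cvg_cst.
exact: cvg_comp z1 (@coord_continuous _ _ _ i 0 _).
Qed.

(** The x-part and the y-part may come from different trajectories, as the
    x-part of a saddle point is orthogonal to the whole image of B. *)
Lemma gda_converges_payoff0 (R : realType) (m n : nat) (B : 'M[R]_(m, n))
    (alpha beta : nat -> R) (z z' : 'cV[R]_m * 'cV[R]_n) :
  gda_converges (bilinear_payoff B) alpha beta ->
  bilinear_payoff B (gda (bilinear_payoff B) alpha beta z t).1
    (gda (bilinear_payoff B) alpha beta z' t).2 @[t --> \oo] --> (0 : R).
Proof.
move=> gda_cvg; have [l lP zl] := gda_cvg z; have [l' _ zl'] := gda_cvg z'.
by rewrite -(saddle_payoff0 l'.2 lP); exact: cvg_bilinear_payoff.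
Qed.

(** * Divergence in the two sign regimes *)

Lemma exists_image_neq0 (R : realType) (m n : nat) (B : 'M[R]_(m, n)) :
  B <> 0 -> exists v : 'cV[R]_n, B *m v != 0.
Proof.
move=> /eqP B0; have [i [j Bij]] : exists i j, B i j != 0.
  apply: contrapT => nB; move/eqP: B0; apply; apply/matrixP => i j.
  by rewrite mxE; apply/eqP; apply: contrapT => /negP ?; apply: nB; exists i, j.
exists (delta_mx j 0); apply: contra_neq Bij => /colP/(_ i).
by rewrite -colE !mxE.
Qed.

(** The first-order terms are symmetric in the two trajectories, so they cancel
    in the difference q, which obeys q' k = q k + (alpha t * beta t) q (k + 1)
    exactly. *)
Lemma gda_diverges_same_sign (R : realType) (m n : nat) (B : 'M[R]_(m, n))
    (alpha beta : nat -> R) :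
  B <> 0 -> (forall t, 0 <= alpha t * beta t) ->
  ~ gda_converges (bilinear_payoff B) alpha beta.
Proof.
move=> /exists_image_neq0[v Bv0] ab_ge0 gda_cvg.
(* One trajectory starts with y = 0 and the other with x = 0, so that only the
   first term of q survives at time 0, where it is a diagonal moment of v. *)
pose w := gda (bilinear_payoff B) alpha beta (B *m v, 0).
pose w' := gda (bilinear_payoff B) alpha beta (0, v).
pose q t k := moment B k (B^T *m (w t).1) (w' t).2
            - moment B k (B^T *m (w' t).1) (w t).2.
have q0 k : q 0%N k = moment B k.+1 v v.
  by rewrite /q /= moment_graml mulmx0 moment0l subr0.
apply: (moment_sequence_no_decay (q := q) ab_ge0) => [k||t k|].
- by rewrite q0 moment_ge0.
- by rewrite q0 moment1E sqnorm_gt0.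
- rewrite /q /w /w' !moment_gdaS -/w -/w' (momentC _ _ (w' t).2 (w t).2).
  rewrite (momentC _ _ (B^T *m (w' t).1) (B^T *m (w t).1)).
  by rewrite le_eqVlt; apply/orP; left; apply/eqP; ring.
rewrite -(subr0 (0 : R)) (_ : q^~ 0%N = fun t =>
  bilinear_payoff B (w t).1 (w' t).2 - bilinear_payoff B (w' t).1 (w t).2).
  by apply: cvgB; exact: gda_converges_payoff0.
by apply/funext => t; rewrite !payoff_moment.
Qed.

(** The sign s makes both first-order terms of s * q_k nonnegative, and then
    - alpha t * beta t, the coefficient of order two, is nonnegative too. *)
Lemma gda_diverges_opposite_sign (R : realType) (m n : nat)
    (B : 'M[R]_(m, n)) (alpha beta : nat -> R) (s : R) :
  B <> 0 -> s ^+ 2 = 1 ->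
  (forall t, s * alpha t <= 0) -> (forall t, 0 <= s * beta t) ->
  ~ gda_converges (bilinear_payoff B) alpha beta.
Proof.
move=> /exists_image_neq0[v Bv0] s2 sa_le0 sb_ge0 gda_cvg.
have ab_le0 t : 0 <= - (alpha t * beta t).
  rewrite -[alpha t * _]mul1r -s2 (_ : - _ = - (s * alpha t) * (s * beta t)).
    by rewrite mulr_ge0 // oppr_ge0.
  by ring.
(* The factor s in the initial x cancels the one in q, by s ^+ 2 = 1. *)
pose w := gda (bilinear_payoff B) alpha beta (s *: (B *m v), v).
pose q t k := s * moment B k (B^T *m (w t).1) (w t).2.
have q0 k : q 0%N k = moment B k.+1 v v.
  rewrite /q /= -scalemxAr -[s *: _]add0r momentDl moment_graml.
  by rewrite moment0l add0r mulrA -expr2 s2 mul1r.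
apply: (moment_sequence_no_decay (q := q) ab_le0) => [k||t k|].
- by rewrite q0 moment_ge0.
- by rewrite q0 moment1E sqnorm_gt0.
- rewrite /q /w moment_gdaS -/w -subr_ge0.
  set my := moment B k.+1 (w t).2 _; set mx := moment B k (B^T *m _) (B^T *m _).
  rewrite (_ : _ - _ = - (s * alpha t) * my + s * beta t * mx); last by ring.
  by apply: addr_ge0; apply: mulr_ge0; rewrite ?oppr_ge0 ?moment_ge0.
rewrite -(mulr0 s) (_ : q^~ 0%N = fun t =>
  s * bilinear_payoff B (w t).1 (w t).2).
  by apply: cvgM; [exact: cvg_cst|exact: gda_converges_payoff0].
by apply/funext => t; rewrite payoff_moment.
Qed.

Theorem lemma2p2 (R : realType) (dx dy : nat)
    (hdx : (1 <= dx)%N) (hdy : (1 <= dy)%N)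
    (B : 'M[R]_(dx, dy)) (hB : B <> 0) (alpha beta : nat -> R)
    (hsteps : constant_steps alpha beta \/ nonneg_steps alpha beta \/
              symmetric_steps alpha beta) :
  ~ gda_converges (bilinear_payoff B) alpha beta.
Proof.
case: hsteps => [[a [b ab]]|[ab_ge0|ab]]; last first.
- by apply: gda_diverges_same_sign => // t; rewrite ab -expr2 sqr_ge0.
- apply: gda_diverges_same_sign => // t.
  by have [? ?] := ab_ge0 t; rewrite mulr_ge0.
have [alphaE betaE] : alpha = (fun=> a) /\ beta = (fun=> b).
  by split; apply/funext => t; have [] := ab t.
rewrite alphaE betaE.
have [ab_ge0|ab_lt0] := leP 0 (a * b).
  exact: gda_diverges_same_sign.
have [a_le0|a_gt0] := leP a 0.
  apply: (gda_diverges_opposite_sign (s := 1)) => // [|_|_];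
    by rewrite ?expr1n ?mul1r //; nra.
apply: (gda_diverges_opposite_sign (s := -1)) => // [|_|_];
  by rewrite ?sqrrN ?expr1n ?mulN1r //; nra.
Qed.
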